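(* Let $\mathbb{X}$ be a Polish space with Borel $\sigma$-algebra $\mathcal{B}$ and let $\preceq$ be a closed partial order on $\mathbb{X}$. Let $Q$ be a stochastic kernel on $(\mathbb{X}, \mathcal{B})$, let $V \colon \mathbb{X} \to [1,\infty)$ be measurable, and let $\lambda, \beta \geq 0$ be constants such that $$QV(x) \leq \lambda V(x) + \beta \quad \text{for all } x \in \mathbb{X}.$$ Fix $d \geq 1$ and set $$\gamma := \lambda + \frac{2\beta}{d}, \qquad C := \{x \in \mathbb{X} : V(x) \leq d\}, \qquad \epsilon := \inf\{\alpha(Q_x, Q_{x'}) : (x,x') \in C \times C\}.$$ Let $\mu, \mu'$ be probability measures on $\mathcal{B}$ and set $$H(\mu,\mu') := \frac{1}{2}\left[\int V \, d\mu + \int V \, d\mu'\right].$$ If $Q$ is increasing, then, for any $j, t \in \mathbb{N}$ with $j \leq t$, $$\kappa(\mu Q^t, \mu' Q^t) \leq (1-\epsilon)^j + \gamma^t d^{\,j-1} H(\mu,\mu').$$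
   Context: A partial order $\preceq$ on $\mathbb{X}$ is closed if its graph $\mathbb{G} := \{(x',x) \in \mathbb{X}\times\mathbb{X} : x' \preceq x\}$ is closed in the product topology on $\mathbb{X}\times\mathbb{X}$. A map $h \colon \mathbb{X} \to \mathbb{R}$ is increasing if $x \preceq x'$ implies $h(x) \leq h(x')$. Write $ib\mathcal{B}$ for the set of all increasing bounded Borel measurable functions $h \colon \mathbb{X} \to \mathbb{R}$. For probability measures $\mu, \nu$ on $\mathcal{B}$, the Kolmogorov distance is $$\kappa(\mu,\nu) := \sup\left\{\left|\int h\,d\mu - \int h\,d\nu\right| : h \in ib\mathcal{B},\ 0 \leq h \leq 1\right\}.$$ A stochastic kernel on $(\mathbb{X},\mathcal{B})$ is a map $Q \colon \mathbb{X}\times\mathcal{B} \to [0,1]$ such that $x \mapsto Q(x,A)$ is measurable for each $A \in \mathcal{B}$ and $A \mapsto Q(x,A)$ is a probability measure for each $x \in \mathbb{X}$; write $Q_x := Q(x,\cdot)$. For a measure $\mu$ and a function $f$ (bounded measurable or nonnegative measurable), $\mu Q(A) := \int Q(x,A)\,\mu(dx)$ and $Qf(x) := \int f(y)\,Q(x,dy)$; $\mu Q^t$ denotes $t$-fold application of $\mu \mapsto \mu Q$. The kernel $Q$ is increasing if $Qh \in ib\mathcal{B}$ whenever $h \in ib\mathcal{B}$. A coupling of $(\mu,\nu)$ is a probability measure $\rho$ on $\mathcal{B}\otimes\mathcal{B}$ with $\rho(A\times\mathbb{X}) = \mu(A)$ and $\rho(\mathbb{X}\times A) = \nu(A)$ for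 all $A \in \mathcal{B}$; $\mathscr{C}(\mu,\nu)$ denotes the set of all couplings of $(\mu,\nu)$. Define $$\alpha(\mu,\nu) := \sup_{\rho \in \mathscr{C}(\mu,\nu)} \rho(\mathbb{G}) \in [0,1].$$ The infimum defining $\epsilon$ is taken in $[0,1]$ (so $\epsilon = 1$ if $C$ is empty). $H(\mu,\mu')$ may be $+\infty$, in which case the bound is trivial. *)

(* Defs.v *)
From HB Require Import structures.
From mathcomp Require Import all_boot all_order all_algebra.
From mathcomp Require Import all_classical all_reals all_analysis.

Set Implicit Arguments.
Unset Strict Implicit.
Unset Printing Implicit Defensive.

Import Order.TTheory GRing.Theory Num.Theory.
Import numFieldNormedType.Exports.

Local Open Scope classical_set_scope.
Local Open Scope ring_scope.

(* Polishness is a property of the topology: the metric is existentially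
   quantified and the topology it induces must be the given one. *)
Section polish.
Context (R : realType) (X : topologicalType).
Implicit Type dist : X -> X -> R.

Definition is_metric dist := [/\ (forall x y, 0 <= dist x y),
  (forall x y, dist x y = 0 <-> x = y),
  (forall x y, dist x y = dist y x) &
  (forall x y z, dist x z <= dist x y + dist y z)].

Definition metrizes dist := forall (x : X) (A : set X),
  nbhs x A <-> exists2 e, 0 < e & [set y | dist x y < e] `<=` A.

Definition metric_complete dist := forall u : nat -> X,
  (forall e, 0 < e -> exists N, forall m n, (N <= m)%N -> (N <= n)%N ->
    dist (u m) (u n) < e) ->
  exists l : X, u @ \oo --> l.

Definition separable_space := exists2 A : set X, countable A & dense A.

Definition polish_space := separable_space /\
  exists dist, [/\ is_metric dist, metrizes dist & metric_complete dist].

End polish.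

Notation borel X := (g_sigma_algebraType (@open X)).

Definition graph_of (T : Type) (le : rel T) : set (T * T) :=
  [set p | le p.1 p.2].

Definition closed_partial_order (X : topologicalType) (le : rel X) :=
  [/\ reflexive le, antisymmetric le, transitive le & closed (graph_of le)].
Arguments closed_partial_order X le : clear implicits.

Section increasing.
Context d (T : measurableType d) (R : realType) (le : rel T).

Definition ibB : set (T -> R) := [set h : T -> R |
  [/\ {homo h : x y / le x y >-> x <= y}, bounded_fun (h : T -> R^o)
    & measurable_fun [set: T] h]].

Definition kolmogorov_dist (mu nu : probability T R) : \bar R :=
  ereal_sup [set `| \int[mu]_x (h x)%:E - \int[nu]_x (h x)%:E |%E
            | h in [set h | ibB h /\ forall x, 0 <= h x <= 1]].

Definition increasing_kernel (Q : R.-pker T ~> T) :=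
  forall h, ibB h -> ibB (fun x => \int[Q x]_y h y).

(* [mu] and [nu] are typed as measures because [Q x] is, for a kernel [Q]. *)
Definition couplings (mu nu : {measure set T -> \bar R}) :
    set (probability (T * T)%type R) :=
  [set rho | forall A, measurable A ->
    rho (A `*` setT) = mu A /\ rho (setT `*` A) = nu A].

Definition alpha (mu nu : {measure set T -> \bar R}) : \bar R :=
  ereal_sup [set rho (graph_of le) | rho in couplings mu nu].

(* The infimum is taken in [0, 1]. As [alpha] is at most 1, the minimum with 1
   only matters when [C] is empty, where [ereal_inf set0 = +oo]. *)
Definition epsilon (Q : R.-pker T ~> T) (C : set T) : \bar R :=
  mine 1%E (ereal_inf [set alpha (Q p.1) (Q p.2) | p in C `*` C]).

End increasing.

Section kernel_action.
Context d (T : measurableType d) (R : realType).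
Variables (Q : R.-pker T ~> T) (mu : probability T R).

Definition kact (A : set T) : \bar R := (\int[mu]_x Q x A)%E.

Let kact0 : kact set0 = 0%E.
Proof. by apply: integral0_eq => x _; rewrite measure0. Qed.

Let kact_ge0 A : (0 <= kact A)%E.
Proof. exact: integral_ge0. Qed.

Let kact_sigma_additive : semi_sigma_additive kact.
Proof.
move=> F mF tF mUF; rewrite /kact.
rewrite (_ : (\int[mu]_x _)%E = (\sum_(n <oo) \int[mu]_x Q x (F n))%E).
  by apply: is_cvg_ereal_nneg_natsum => n _; exact: integral_ge0.
rewrite -integral_nneseries//; last by move=> n; exact: measurable_kernel.
apply: eq_integral => x _.
by apply/esym/cvg_lim => //; exact: measure_semi_sigma_additive.
Qed.

HB.instance Definition _ := isMeasure.Build d T R kact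
  kact0 kact_ge0 kact_sigma_additive.

Let kact_setT : kact setT = 1%E.
Proof.
rewrite /kact; under eq_integral do rewrite prob_kernel.
by rewrite integral_cst// mul1e; exact: probability_setT.
Qed.

HB.instance Definition _ := Measure_isProbability.Build d T R kact kact_setT.

Definition kernel_action : probability T R := kact.

End kernel_action.

Definition kernel_iter d (T : measurableType d) (R : realType)
    (Q : R.-pker T ~> T) (t : nat) (mu : probability T R) : probability T R :=
  iter t (kernel_action Q) mu.

(* Main.v *)
Require Import Defs.
From HB Require Import structures.
From mathcomp Require Import all_boot all_order all_algebra.
From mathcomp Require Import all_classical all_reals all_analysis.
From mathcomp Require Import measurable_realfun ring lra.

(** Write Kh for the function x |-> \int[Q x] h and W(x, y) for
    (V x + V y) / 2. Since the integral of h against mu Q^t is the integral of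
    K^t h against mu, everything reduces to a pointwise bound on the
    oscillation of K^t h, for h increasing with values in [0, 1]:

      K^t h (x) - K^t h (y) <= (1 - eps)^j + gamma^t d^(j-1) W(x, y),

    which is [iter_kernel_op_le]. Integrating this against mu in x and mu' in y,
    and once more with mu and mu' exchanged, gives the theorem.

    The pointwise bound follows by induction on t. For any coupling rho of
    (Q x, Q y), the oscillation of K^(t+1) h at (x, y) is the rho-integral of
    the oscillation of K^t h, and the latter is nonpositive on the graph of the
    order because K^t h is increasing; this is [coupling_integral_le].

    - If V x <= d and V y <= d, couplings with mass close to alpha (Q x) (Q y),
      hence almost eps, on the graph of the order turn the bound for j - 1 into
      one whose first term has an additional factor 1 - eps
      ([alpha_integral_le]). The drift condition costs at most a factor
      gamma d in the second term, so both exponents j and t go up by one.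
    - Otherwise 2 W(x, y) > d, which absorbs the additive constant of the drift:
      W is contracted by the factor gamma alone. Any coupling will do
      ([oscillation_integral_le]), and the bound for the same j, applied at
      time t, suffices.
    - The second case has no bound at time t to rely on when j = t + 1. There
      the claimed right-hand side is at least 1: V >= 1 forces gamma d >= 1
      ([drift_rate_ge1]), and gamma W(x, y) >= 1.

    Only values of alpha enter, so no measurable choice of couplings in (x, y)
    is needed. In the lemmas on the drift condition, the height d of the
    sublevel set is called b. The measurability of the graph of the order for
    the product sigma-algebra comes from second countability
    ([measurable_open_prod]). *)

Import Order.TTheory GRing.Theory Num.Theory.
Import numFieldNormedType.Exports.
Local Open Scope classical_set_scope.
Local Open Scope ring_scope.

Set Implicit Arguments.
Unset Strict Implicit.

(** * Open sets in products of second countable spaces *)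

(** The balls of radius 1/(n+1) around the points of a countable dense set form
    a basis. *)
Lemma separable_metrizable_second_countable (R : realType) (X : topologicalType)
    (dist : X -> X -> R) :
  is_metric dist -> metrizes dist -> separable_space X ->
  @second_countable X.
Proof.
move=> [d0 dE dC dT] dM [A cA dA].
pose B (a : X) (n : nat) := [set y | dist a y < n.+1%:R^-1].
have n0 n : 0 < n.+1%:R^-1 :> R by rewrite invr_gt0.
have oB a n : open (B a n).
  rewrite openE => z Bz; rewrite /interior; apply/dM.
  exists (n.+1%:R^-1 - dist a z); first by rewrite subr_gt0.
  move=> y /=; rewrite ltrBrDl => h.
  exact: le_lt_trans (dT _ _ _) h.
exists [set B p.1 p.2 | p in A `*` setT].
  apply: (sub_countable (card_image_le _ _)).
  exact: countableX.
split=> [_ [p _ <-]|x U xU]; first exact: oB.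
have /dM[e e0 eU] := xU.
have e20 : 0 < e / 2 by rewrite divr_gt0.
(* The radius is at most e / 2: the distances from x to the centre a and from
   a to any other point of the ball around a add up to less than e. *)
have [n _ /(_ n (leqnn n)) /= ne] := near_infty_natSinv_lt (PosNum e20).
have [|a [/= xa Aa]] := dA (B x n) _ (oB x n).
  by exists x; rewrite /B /= (dE x x).2.
exists (B a n); first by split; [exists (a, n)|rewrite /B /= dC].
move=> y ay; apply: eU => /=.
rewrite (splitr e); apply: (le_lt_trans (dT x a y)).
by rewrite ltrD// (lt_trans _ ne).
Qed.

Lemma countable_bigcup_measurable d (T : sigmaRingType d) (I : Type)
    (D : set I) (F : I -> set T) :
  countable D -> (forall i, D i -> measurable (F i)) ->
  measurable (\bigcup_(i in D) F i).
Proof.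
move=> /countable_injP[f finj] mF.
rewrite (_ : \bigcup_(i in D) _ =
    \bigcup_n \bigcup_(i in [set i | D i /\ f i = n]) F i); last first.
  apply/seteqP; split=> [x [i Di Fix]|x [_ _ [i [Di _] Fix]]].
  - by exists (f i) => //; exists i.
  - by exists i.
apply: bigcupT_measurable => n.
have [[i [Di fi]]|no] := pselect (exists i, D i /\ f i = n).
  rewrite (_ : [set _ | _] = [set i]) ?bigcup_set1; first exact: mF.
  apply/seteqP; split=> [k /= [Dk fk]|_ ->//].
  by apply: finj; rewrite ?inE// fi fk.
rewrite (_ : [set _ | _] = set0) ?bigcup_set0//.
by apply/seteqP; split=> // i Hi; apply: no; exists i.
Qed.

(** The product of the Borel sigma-algebras may be smaller than the Borel
    sigma-algebra of the product; second countability makes every open set a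
    countable union of open rectangles. *)
Lemma measurable_open_prod (X : ptopologicalType) (U : set (X * X)) :
  @second_countable X -> open U ->
  measurable (U : set (borel X * borel X)).
Proof.
move=> [B cB [oB nB]] oU.
pose D : set (set X * set X) := (B `*` B) `&` [set p | p.1 `*` p.2 `<=` U].
rewrite (_ : U = \bigcup_(p in D) (p.1 `*` p.2)); last first.
  apply/seteqP; split=> [[x y] Uxy|z [p [_ pU]]]; last exact: pU.
  have : nbhs (x, y) U by move: oU; rewrite openE => /(_ _ Uxy).
  case=> -[P Q] /= [xP yQ] PQU.
  have [P' [BP' P'x] P'P] := nB x _ xP.
  have [Q' [BQ' Q'y] Q'Q] := nB y _ yQ.
  exists (P', Q') => //; split=> // -[a b] [/= Pa Qb].
  by apply: PQU; split; [exact: P'P|exact: Q'Q].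
apply: countable_bigcup_measurable.
  apply: (sub_countable _ (countableX cB cB)).
  by apply: subset_card_le => p [].
move=> p [[/oB o1 /oB o2] _].
by apply: measurableX; exact: sub_sigma_algebra.
Qed.

(** * Comparing integrals through couplings *)

Lemma ge0_integral_coupling_fst d (T : measurableType d) (R : realType)
    (m m' : {measure set T -> \bar R}) (rho : probability (T * T)%type R)
    (g : T -> R) :
  couplings m m' rho -> measurable_fun [set: T] g -> (forall x, 0 <= g x) ->
  (\int[rho]_p (g p.1)%:E = \int[m]_x (g x)%:E)%E.
Proof.
move=> cpl mg g0.
transitivity (\int[pushforward rho fst]_x (g x)%:E)%E.
  rewrite ge0_integral_pushforward ?preimage_setT//.
  - exact/measurable_EFinP.
  - by move=> x _; rewrite lee_fin.
apply: eq_measure_integral => A mA _; rewrite /pushforward.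
by rewrite -(cpl A mA).1 setXT.
Qed.

Lemma ge0_integral_coupling_snd d (T : measurableType d) (R : realType)
    (m m' : {measure set T -> \bar R}) (rho : probability (T * T)%type R)
    (g : T -> R) :
  couplings m m' rho -> measurable_fun [set: T] g -> (forall x, 0 <= g x) ->
  (\int[rho]_p (g p.2)%:E = \int[m']_x (g x)%:E)%E.
Proof.
move=> cpl mg g0.
transitivity (\int[pushforward rho snd]_x (g x)%:E)%E.
  rewrite ge0_integral_pushforward ?preimage_setT//.
  - exact/measurable_EFinP.
  - by move=> x _; rewrite lee_fin.
apply: eq_measure_integral => A mA _; rewrite /pushforward.
by rewrite -(cpl A mA).2 setTX.
Qed.

(** Both sides are integrals against the coupling rho, where the pointwise
    hypothesis can be integrated. The set E is meant to contain the pairs on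
    which f may decrease. *)
Lemma coupling_integral_le d (T : measurableType d) (R : realType)
    (m m' : {measure set T -> \bar R}) (rho : probability (T * T)%type R)
    (f V : T -> R) (E : set (T * T)) (c a : R) :
  couplings m m' rho -> measurable E ->
  measurable_fun [set: T] f -> (forall x, 0 <= f x) ->
  measurable_fun [set: T] V -> (forall x, 0 <= V x) ->
  0 <= c -> 0 <= a ->
  (forall x y, f x <= f y + (c * \1_E (x, y) + a * (V x + V y))) ->
  (\int[m]_x (f x)%:E <= \int[m']_x (f x)%:E +
     (c%:E * rho E + a%:E * (\int[m]_x (V x)%:E + \int[m']_x (V x)%:E)))%E.
Proof.
move=> cpl mE mf f0 mV V0 c0 a0 fV.
rewrite -(ge0_integral_coupling_fst cpl mf f0).
rewrite -(ge0_integral_coupling_snd cpl mf f0).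
rewrite -(ge0_integral_coupling_fst cpl mV V0).
rewrite -(ge0_integral_coupling_snd cpl mV V0).
have m1 (g : T -> R) : measurable_fun [set: T] g ->
    measurable_fun [set: T * T] (fun p => (g p.1)%:E).
  by move=> mg; apply/measurable_EFinP; exact: measurableT_comp.
have m2 (g : T -> R) : measurable_fun [set: T] g ->
    measurable_fun [set: T * T] (fun p => (g p.2)%:E).
  by move=> mg; apply/measurable_EFinP; exact: measurableT_comp.
have mI : measurable_fun [set: T * T] (fun p => (\1_E p : R)%:E).
  by apply/measurable_EFinP; exact: measurable_indic.
have mVV : measurable_fun [set: T * T] (fun p => (V p.1)%:E + (V p.2)%:E)%E.
  by apply: emeasurable_funD; [exact: m1|exact: m2].
have mcI : measurable_fun [set: T * T] (fun p => c%:E * (\1_E p)%:E)%E.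
  exact: measurable_funeM.
have maV : measurable_fun [set: T * T]
    (fun p => a%:E * ((V p.1)%:E + (V p.2)%:E))%E.
  exact: measurable_funeM.
have f20 p : (0 <= (f p.2)%:E)%E by rewrite lee_fin.
have cI0 p : (0 <= c%:E * (\1_E p)%:E :> \bar R)%E.
  by rewrite mule_ge0// lee_fin.
have aV0 p : (0 <= a%:E * ((V p.1)%:E + (V p.2)%:E) :> \bar R)%E.
  by rewrite mule_ge0// lee_fin addr_ge0.
have mS : measurable_fun [set: T * T] (fun p => c%:E * (\1_E p)%:E +
    a%:E * ((V p.1)%:E + (V p.2)%:E))%E by exact: emeasurable_funD.
rewrite [leRHS](_ : _ = \int[rho]_p ((f p.2)%:E +
    (c%:E * (\1_E p)%:E + a%:E * ((V p.1)%:E + (V p.2)%:E))))%E; last first.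
  rewrite ge0_integralD//; last 2 first.
  - exact: m2.
  - by move=> p _; rewrite adde_ge0.
  rewrite ge0_integralD//; congr (_ + (_ + _))%E.
    by rewrite ge0_integralZl// integral_indic// setIT.
  rewrite ge0_integralZl//; last by move=> p _; rewrite adde_ge0// lee_fin.
  congr (_ * _)%E; apply/esym; apply: ge0_integralD => //.
  - by move=> p _; rewrite lee_fin.
  - exact: m1.
  - by move=> p _; rewrite lee_fin.
  - exact: m2.
apply: ge0_le_integral => //.
- by move=> *; rewrite lee_fin.
- exact: m1.
- by apply: emeasurable_funD; [exact: m2|].
- by move=> [x y] _; exact: fV.
Qed.

Section probability_of_measure.
Context d (T : measurableType d) (R : realType).
Context (m : {measure set T -> \bar R}) (m1 : m setT = 1%E).

Let p : set T -> \bar R := m.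

HB.instance Definition _ := Measure.on p.
HB.instance Definition _ := Measure_isProbability.Build d T R p m1.

(** The values of a probability kernel are only typed as measures; this bundles
    them as probabilities, so that products of them are probabilities too. *)
Definition probability_of_measure : probability T R := p.

End probability_of_measure.

Lemma couplings_nonempty d (T : measurableType d) (R : realType)
    (m m' : {measure set T -> \bar R}) :
  m setT = 1%E -> m' setT = 1%E -> couplings m m' !=set0.
Proof.
move=> m1 m'1.
pose P := probability_of_measure m1; pose P' := probability_of_measure m'1.
exists (P \x P')%E => A mA; split.
- by rewrite [LHS]product_measure1E//= m'1 mule1.
- by rewrite [LHS]product_measure1E//= m1 mul1e.
Qed.

(** Any coupling, for instance the product, gives this bound: it corresponds to
    the choice of the full space as exceptional set. *)
Lemma oscillation_integral_le d (T : measurableType d) (R : realType)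
    (m m' : {measure set T -> \bar R}) (f V : T -> R) (c a : R) :
  m setT = 1%E -> m' setT = 1%E ->
  measurable_fun [set: T] f -> (forall x, 0 <= f x) ->
  measurable_fun [set: T] V -> (forall x, 0 <= V x) ->
  0 <= c -> 0 <= a ->
  (forall x y, f x <= f y + (c + a * (V x + V y))) ->
  (\int[m]_x (f x)%:E <= \int[m']_x (f x)%:E +
     (c%:E + a%:E * (\int[m]_x (V x)%:E + \int[m']_x (V x)%:E)))%E.
Proof.
move=> m1 m'1 mf f0 mV V0 c0 a0 fV.
have [rho cpl] := couplings_nonempty m1 m'1.
rewrite -[c%:E]mule1 -(@probability_setT _ _ _ rho).
apply: coupling_integral_le => // x y.
by rewrite indicT mulr1.
Qed.

(** The monotonicity of f removes the constant c on the graph of the order, so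
    that only the mass of its complement is paid for. As alpha is a supremum
    that need not be attained, the bound is proved up to an arbitrary delta. *)
Lemma alpha_integral_le d (T : measurableType d) (R : realType) (le : rel T)
    (m m' : {measure set T -> \bar R}) (f V : T -> R) (c a e : R) :
  measurable (graph_of le) -> (e%:E <= alpha le m m')%E ->
  {homo f : x y / le x y >-> x <= y} ->
  measurable_fun [set: T] f -> (forall x, 0 <= f x) ->
  measurable_fun [set: T] V -> (forall x, 0 <= V x) ->
  0 <= c -> 0 <= a ->
  (forall x y, f x <= f y + (c + a * (V x + V y))) ->
  (\int[m]_x (f x)%:E <= \int[m']_x (f x)%:E + ((c * (1 - e))%:E +
     a%:E * (\int[m]_x (V x)%:E + \int[m']_x (V x)%:E)))%E.
Proof.
move=> mG ea fle mf f0 mV V0 c0 a0 fV.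
apply/lee_addgt0Pr => delta delta0.
have c1 : 0 < c + 1 by rewrite ltr_wpDl.
(* c + 1 rather than c: the constant c may vanish. *)
have : ((e - delta / (c + 1))%:E < alpha le m m')%E.
  by rewrite (lt_le_trans _ ea)// lte_fin ltrBlDr ltrDl divr_gt0.
move=> /ereal_sup_gt[_ [rho cpl <-]] rhoG.
have G1 : (rho (graph_of le) <= 1)%E by exact: probability_le1.
have cE : (c%:E * rho (~` graph_of le) <= (c * (1 - e))%:E + delta%:E)%E.
  rewrite probability_setC//.
  move: rhoG G1; case: (rho (graph_of le)) => [g| |]//.
  rewrite lte_fin => eg _.
  rewrite -EFinB -EFinM -EFinD lee_fin.
  have : c * (1 - g) <= c * (1 - e + delta / (c + 1)).
    by rewrite ler_wpM2l//; lra.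
  move=> /le_trans; apply; rewrite mulrDr lerD2l mulrA ler_pdivrMr//.
  by rewrite mulrDr mulr1 mulrC lerDl ltW.
apply: (@le_trans _ _ (\int[m']_x (f x)%:E + (c%:E * rho (~` graph_of le) +
    a%:E * (\int[m]_x (V x)%:E + \int[m']_x (V x)%:E)))%E).
  apply: coupling_integral_le => //; first exact: measurableC.
  move=> x y; rewrite indicE; have [xy|xy] := boolP (le x y).
    rewrite memNset ?mulr0 ?add0r; last by apply.
    rewrite (le_trans (fle _ _ xy))// lerDl.
    by rewrite mulr_ge0// addr_ge0.
  by rewrite mem_set ?mulr1//; exact/negP.
by rewrite -[leRHS]addeA leeD2l// [leRHS]addeAC leeD2r.
Qed.

(** * Action of a kernel on functions *)

(** The action of Q on a measure is the composition of Q with a kernel that is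
    constant, here indexed by the one-point space. *)
Lemma integral_kernel_action d (T : measurableType d) (R : realType)
    (Q : R.-pker T ~> T) (m : probability T R) (f : T -> \bar R) :
  (forall x, (0 <= f x)%E) -> measurable_fun [set: T] f ->
  (\int[kernel_action Q m]_x f x = \int[m]_x \int[Q x]_y f y)%E.
Proof.
move=> f0 mf.
pose l := kprobability (@measurable_cst _ _ unit (pprobability T R) setT m).
pose k := @kernel.kernel_snd _ _ _ unit T T R Q.
rewrite -[RHS](integral_kcomp l k tt f0 mf).
by apply: eq_measure_integral.
Qed.

Definition kernel_op d (T : measurableType d) (R : realType)
  (Q : R.-pker T ~> T) (h : T -> R) (x : T) : R := \int[Q x]_y h y.

Definition unit_ibB d (T : measurableType d) (R : realType) (le : rel T) :
    set (T -> R) := [set h | ibB le h /\ forall x, 0 <= h x <= 1].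

Section kernel_op.
Context d (T : measurableType d) (R : realType) (le : rel T).
Context (Q : R.-pker T ~> T) (Qinc : increasing_kernel le Q).

Lemma integral_unit_bounds (m : {measure set T -> \bar R}) (h : T -> R) :
  m setT = 1%E -> unit_ibB le h -> (0 <= \int[m]_x (h x)%:E <= 1)%E.
Proof.
move=> m1 [[_ _ mh] h01]; apply/andP; split.
  by apply: integral_ge0 => x _; rewrite lee_fin; case/andP: (h01 x).
rewrite -m1 -[leRHS]mul1e -(integral_cst _ measurableT).
apply: ge0_le_integral => //.
- by move=> x _; rewrite lee_fin; case/andP: (h01 x).
- exact/measurable_EFinP.
- by move=> x _; rewrite lee_fin; case/andP: (h01 x).
Qed.

Lemma EFin_kernel_op h x :
  unit_ibB le h -> (kernel_op Q h x)%:E = (\int[Q x]_y (h y)%:E)%E.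
Proof.
move=> hU.
have /andP[i0 i1] := integral_unit_bounds (@prob_kernel _ _ _ _ _ Q x) hU.
by rewrite /kernel_op /Rintegral fineK// ge0_fin_numE// (le_lt_trans i1)// ltry.
Qed.

Lemma unit_ibB_kernel_op h : unit_ibB le h -> unit_ibB le (kernel_op Q h).
Proof.
move=> hU; split=> [|x]; first by apply: Qinc; exact: hU.1.
have := integral_unit_bounds (@prob_kernel _ _ _ _ _ Q x) hU.
by rewrite -EFin_kernel_op// !lee_fin.
Qed.

Lemma unit_ibB_iter h t : unit_ibB le h -> unit_ibB le (iter t (kernel_op Q) h).
Proof. by elim: t => //= t IH /IH; exact: unit_ibB_kernel_op. Qed.

(** Duality between the action of Q on measures and its action on functions. *)
Lemma integral_kernel_iter (m : probability T R) h t : unit_ibB le h ->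
  (\int[kernel_iter Q t m]_x (h x)%:E =
   \int[m]_x (iter t (kernel_op Q) h x)%:E)%E.
Proof.
elim: t h => // t IH h hU.
rewrite iterSr -IH; last exact: unit_ibB_kernel_op.
rewrite [LHS]integral_kernel_action; first last.
- by apply/measurable_EFinP; case: hU => -[].
- by move=> x; rewrite lee_fin; case/andP: (hU.2 x).
by apply: eq_integral => x _; rewrite EFin_kernel_op.
Qed.

End kernel_op.

(** * Oscillation of iterates under a drift condition *)

Section drift.
Context d (T : measurableType d) (R : realType) (Q : R.-pker T ~> T).
Context (V : T -> R) (lambda beta b : R).
Context (mV : measurable_fun [set: T] V) (V1 : forall x, 1 <= V x).
Context (lambda0 : 0 <= lambda) (beta0 : 0 <= beta) (b1 : 1 <= b).
Context (drift :
  forall x, (\int[Q x]_y (V y)%:E <= (lambda * V x + beta)%:E)%E).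

Let gamma := lambda + 2 * beta / b.

Let V0 x : 0 <= V x. Proof. exact: le_trans (V1 x). Qed.

Let b0 : 0 < b. Proof. exact: lt_le_trans b1. Qed.

Let gamma0 : 0 <= gamma.
Proof. by rewrite addr_ge0// divr_ge0// ?mulr_ge0// ltW. Qed.

Let gammaE : gamma * b = lambda * b + 2 * beta.
Proof. by rewrite /gamma; field; rewrite lt0r_neq0. Qed.

(** Averaging V against a probability cannot go below a lower bound of V. *)
Lemma lower_bound_le_drift (v : R) x :
  0 <= v -> (forall y, v <= V y) -> v <= lambda * V x + beta.
Proof.
move=> v0 vV; rewrite -lee_fin; apply: le_trans (drift x).
rewrite -[leLHS]mule1 -(@prob_kernel _ _ _ _ _ Q x).
rewrite -(integral_cst _ measurableT).
apply: ge0_le_integral => //; first exact/measurable_EFinP.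
by move=> y _; rewrite lee_fin.
Qed.

(** If some x satisfies V x <= b, the drift condition at x already gives this,
    since \int[Q x] V >= 1. Otherwise V > b everywhere, so Q multiplies V by at
    most gamma; as Q cannot bring V below its infimum, gamma >= 1. *)
Lemma drift_rate_ge1 (x0 : T) : 1 <= gamma * b.
Proof.
have [[x Vx]|noC] := pselect (exists x, V x <= b).
  have := lower_bound_le_drift x ler01 V1; rewrite gammaE.
  have : lambda * V x <= lambda * b by rewrite ler_wpM2l.
  by move: beta0; lra.
have Vb x : b < V x by rewrite ltNge; apply/negP => Vx; apply: noC; exists x.
suff g1 : 1 <= gamma by rewrite (le_trans b1)// ler_peMl// ltW.
pose v := inf (range V).
have V_lb : has_lbound (range V) by exists 1 => _ [x _ <-].
have V_ne : range V !=set0 by exists (V x0), x0.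
have vV x : v <= V x by apply: ge_inf => //; exists x.
have v1 : 1 <= v by apply: lb_le_inf => // _ [x _ <-].
have vg x : v <= gamma * V x.
  apply: (le_trans (lower_bound_le_drift x _ vV)); first exact: le_trans v1.
  rewrite mulrDl lerD2l mulrAC ler_pdivlMr//.
  have : beta * b <= beta * V x by rewrite ler_wpM2l// ltW.
  have : 0 <= beta * V x by rewrite mulr_ge0.
  by lra.
have gpos : 0 < gamma.
  rewrite lt_neqAle gamma0 andbT eq_sym; apply/negP => /eqP g0.
  by have := vg x0; rewrite g0 mul0r; lra.
have : v / gamma <= v.
  by apply: lb_le_inf => // _ [x _ <-]; rewrite ler_pdivrMr// mulrC.
by rewrite ler_pdivrMr// ler_pMr// (lt_le_trans _ v1).
Qed.

Context (le : rel T) (mG : measurable (graph_of le)).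
Context (Qinc : increasing_kernel le Q).
Context (e : R) (e1 : e <= 1).
Context (alpha_ge : forall x y, V x <= b -> V y <= b ->
  (e%:E <= alpha le (Q x) (Q y))%E).

(** Transfers an integrated oscillation bound to Q f, replacing the integrals of
    V by their drift bounds. *)
Lemma kernel_op_le (f : T -> R) (c c' a : R) x y :
  unit_ibB le f -> 0 <= a ->
  (\int[Q x]_z (f z)%:E <= \int[Q y]_z (f z)%:E + (c%:E +
     a%:E * (\int[Q x]_z (V z)%:E + \int[Q y]_z (V z)%:E)))%E ->
  c + a * (lambda * (V x + V y) + 2 * beta) <= c' ->
  kernel_op Q f x <= kernel_op Q f y + c'.
Proof.
move=> fU a0 fxy cc'; rewrite -lee_fin EFinD !(@EFin_kernel_op _ _ _ le)//.
apply: (le_trans fxy); rewrite leeD2l//.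
apply: (@le_trans _ _ (c%:E + a%:E * ((lambda * V x + beta)%:E +
    (lambda * V y + beta)%:E))%E).
  by rewrite leeD2l// lee_wpmul2l// leeD.
rewrite -!(EFinD, EFinM) lee_fin; apply: le_trans cc'.
by rewrite lerD2l ler_wpM2l//; lra.
Qed.

(** By induction on t, distinguishing whether both points lie in the sublevel
    set of V at height b. The coefficient b ^ (j - 1) has an integer exponent,
    so that j = 0 is covered; there the bound is at least 1. *)
Lemma iter_kernel_op_le h t j x y : unit_ibB le h -> (j <= t)%N ->
  iter t (kernel_op Q) h x <= iter t (kernel_op Q) h y +
    ((1 - e) ^+ j + gamma ^+ t * b ^ (j%:Z - 1) / 2 * (V x + V y)).
Proof.
move=> hU.
have W0 t' j' : 0 <= gamma ^+ t' * b ^ (j'%:Z - 1) / 2.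
  by rewrite divr_ge0// mulr_ge0 ?exprn_ge0// exprz_ge0// ltW.
have ec0 j' : 0 <= (1 - e) ^+ j' by rewrite exprn_ge0// subr_ge0.
have bS j' : b ^ (j'.+1%:Z - 1) = b ^+ j' by rewrite -addn1 PoszD addrK.
have bSV j' : b ^ (j'.+1%:Z - 1) = b ^ (j'%:Z - 1) * b.
  rewrite -[X in _ * X]expr1z -expfzDr ?lt0r_neq0//.
  by rewrite -addn1 PoszD addrAC.
have trivial_bound t' z z' c : 1 <= c ->
    iter t' (kernel_op Q) h z <= iter t' (kernel_op Q) h z' + c.
  have /= [_ hb] := unit_ibB_iter Qinc t' hU.
  by have := hb z; have := hb z'; lra.
elim: t j x y => [|t IH] [|j] x y jt //.
- by apply: trivial_bound; rewrite expr0 lerDl mulr_ge0// addr_ge0.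
- by apply: trivial_bound; rewrite expr0 lerDl mulr_ge0// addr_ge0.
have [_ hb] := unit_ibB_iter Qinc t hU.
have fU := unit_ibB_iter Qinc t hU.
have mf : measurable_fun [set: T] (iter t (kernel_op Q) h) by case: fU => -[].
have f0 z : 0 <= iter t (kernel_op Q) h z by case/andP: (hb z).
have S2 : 2 <= V x + V y by have := V1 x; have := V1 y; lra.
rewrite iterS.
have [[Vx Vy]|out] := pselect (V x <= b /\ V y <= b).
  have := alpha_integral_le mG (alpha_ge Vx Vy) _ mf f0 mV V0 (ec0 j) (W0 t j)
    (fun z z' => IH j z z' jt).
  move=> /(_ ltac:(by case: fU => -[])) /kernel_op_le; apply => //.
  rewrite exprSr lerD2l bSV exprSr.
  set A := gamma ^+ t * _ ^ _ / 2.
  have -> : gamma ^+ t * gamma * (b ^ (j%:Z - 1) * b) / 2 * (V x + V y) =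
    A * (gamma * b * (V x + V y)) by rewrite /A; ring.
  rewrite ler_wpM2l//; first exact: W0.
  rewrite gammaE.
  have : 0 <= lambda * (V x + V y) * (b - 1).
    by rewrite !mulr_ge0// ?subr_ge0// addr_ge0.
  have : 0 <= beta * (V x + V y - 1) by rewrite mulr_ge0//; lra.
  by lra.
(* Outside of the sublevel set, the sum of the values of V dominates b. *)
have Sb : b <= V x + V y.
  have := V1 x; have := V1 y; have [Vx|] := leP (V x) b; last by lra.
  by have [Vy|] := leP (V y) b; [case: out|lra].
have gS : lambda * (V x + V y) + 2 * beta <= gamma * (V x + V y).
  rewrite /gamma [leRHS]mulrDl lerD2l mulrAC ler_pdivlMr//.
  have : 0 <= beta * (V x + V y - b) by rewrite mulr_ge0//; lra.
  by lra.
have [{}jt|tj] := ltnP j t.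
  have := oscillation_integral_le (@prob_kernel _ _ _ _ _ Q x)
    (@prob_kernel _ _ _ _ _ Q y) mf f0 mV V0 (ec0 j.+1) (W0 t j.+1)
    (fun z z' => IH j.+1 z z' jt).
  move=> /kernel_op_le; apply => //.
  rewrite lerD2l exprSr.
  set A := gamma ^+ t * _ ^ _ / 2.
  have -> : gamma ^+ t * gamma * b ^ (j.+1%:Z - 1) / 2 * (V x + V y) =
    A * (gamma * (V x + V y)) by rewrite /A; ring.
  by rewrite ler_wpM2l//; exact: W0.
(* When j + 1 = t + 1 the induction hypothesis is not available, but the bound
   is at least 1. *)
have {jt tj} -> : j = t by apply/eqP; rewrite eqn_leq -ltnS jt.
apply: (trivial_bound t.+1); apply: ler_wpDl => //.
rewrite bS exprSr.
have -> : gamma ^+ t * gamma * b ^+ t / 2 * (V x + V y) =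
  (gamma * b) ^+ t * (gamma * (V x + V y) / 2) by rewrite exprMn; ring.
apply: mulr_ege1; first by rewrite exprn_ege1// drift_rate_ge1.
have := lower_bound_le_drift x ler01 V1.
have := lower_bound_le_drift y ler01 V1.
lra.
Qed.

End drift.

(** * The bound on the Kolmogorov distance *)

(** The supremum defining alpha is over a nonempty set, so it is not -oo. *)
Lemma epsilon_ge0 d (T : measurableType d) (R : realType) (le : rel T)
    (Q : R.-pker T ~> T) (C : set T) : (0 <= epsilon le Q C)%E.
Proof.
rewrite /epsilon le_min lee01; apply: le_ereal_inf_tmp => _ [[x y] _ <-].
have [rho cpl] := couplings_nonempty (@prob_kernel _ _ _ _ _ Q x)
  (@prob_kernel _ _ _ _ _ Q y).
apply: (@le_trans _ _ (rho (graph_of le))) => //.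
by apply: ereal_sup_ubound; exists rho.
Qed.

Lemma epsilon_le_alpha d (T : measurableType d) (R : realType) (le : rel T)
    (Q : R.-pker T ~> T) (C : set T) x y : C x -> C y ->
  (epsilon le Q C <= alpha le (Q x) (Q y))%E.
Proof.
move=> Cx Cy; rewrite /epsilon ge_min; apply/orP; right.
by apply: ereal_inf_lbound; exists (x, y).
Qed.

Lemma abse_subr_le (R : realDomainType) (a b : R) (K : \bar R) :
  (a%:E <= b%:E + K)%E -> (b%:E <= a%:E + K)%E -> (`|a%:E - b%:E| <= K)%E.
Proof.
case: K => [k| |]; rewrite -?EFinD ?lee_fin//= ?leey//.
move=> ab ba; rewrite ler_norml; apply/andP; split; lra.
Qed.

Unset Implicit Arguments.

Theorem theorem3p1 (R : realType) (X : ptopologicalType) (le : rel (borel X))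
    (Q : R.-pker (borel X) ~> (borel X)) (V : borel X -> R)
    (lambda beta d : R) (mu mu' : probability (borel X) R) (j t : nat) :
  polish_space R X ->
  closed_partial_order X le ->
  measurable_fun [set: borel X] V ->
  (forall x, 1 <= V x) ->
  0 <= lambda ->
  0 <= beta ->
  (forall x, (\int[Q x]_y (V y)%:E <= (lambda * V x + beta)%:E)%E) ->
  1 <= d ->
  increasing_kernel le Q ->
  (j <= t)%N ->
  let gamma := lambda + 2 * beta / d in
  let C := [set x | V x <= d] in
  let eps := epsilon le Q C in
  let H := ((2^-1)%:E * (\int[mu]_x (V x)%:E + \int[mu']_x (V x)%:E))%E in
  (kolmogorov_dist le (kernel_iter Q t mu) (kernel_iter Q t mu')
     <= (1 - eps) ^+ j + (gamma ^+ t * d ^ (j%:Z - 1))%:E * H)%E.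
Proof.
move=> [sepX [dist [dist_metric distM _]]] [_ _ _ closedG].
move=> mV V1 lambda0 beta0 drift d1 Qinc jt; cbv zeta.
set gamma := lambda + _; set C := [set x | V x <= d]; set eps := epsilon _ _ _.
have mG : measurable (graph_of le).
  rewrite -[graph_of le]setCK; apply: measurableC.
  apply: (@measurable_open_prod X); last exact: closed_openC.
  exact: separable_metrizable_second_countable dist_metric distM sepX.
have [e [epsE e1 ealpha]] : exists e : R, [/\ eps = e%:E, e <= 1 &
    forall x y, V x <= d -> V y <= d -> (e%:E <= alpha le (Q x) (Q y))%E].
  have eps0 : (0 <= eps)%E := epsilon_ge0 le Q C.
  have eps1 : (eps <= 1)%E by rewrite /eps /epsilon ge_min lexx.
  have epsE : eps = (fine eps)%:E.
    by rewrite fineK// ge0_fin_numE// (le_lt_trans eps1)// ltry.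
  exists (fine eps); rewrite -!lee_fin -epsE; split=> // x y Vx Vy.
  exact: (@epsilon_le_alpha _ _ _ _ _ C).
have V0 x : 0 <= V x by exact: le_trans (V1 x).
have d0 : 0 <= d by exact: le_trans d1.
have gamma0 : 0 <= gamma by rewrite addr_ge0// divr_ge0// mulr_ge0.
apply: ge_ereal_sup => _ [h hU <-].
have boundE : forall m m' : probability (borel X) R,
    (\int[kernel_iter Q t m]_x (h x)%:E <=
     \int[kernel_iter Q t m']_x (h x)%:E + ((1 - eps) ^+ j +
       (gamma ^+ t * d ^ (j%:Z - 1))%:E *
       ((2^-1)%:E * (\int[m]_x (V x)%:E + \int[m']_x (V x)%:E))))%E.
  move=> m m'; rewrite !(@integral_kernel_iter _ _ _ le)//.
  rewrite epsE -EFinB -EFin_expe muleA -EFinM.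
  have [[_ _ mh] hb] := unit_ibB_iter Qinc t hU.
  apply: (oscillation_integral_le (probability_setT m)
    (probability_setT m')) => //.
  - by move=> x; case/andP: (hb x).
  - by rewrite exprn_ge0// subr_ge0.
  - by rewrite divr_ge0// mulr_ge0 ?exprn_ge0// exprz_ge0.
  - move=> x y.
    exact: (iter_kernel_op_le mV V1 lambda0 beta0 d1 drift mG Qinc e1 ealpha).
have finE (m : probability (borel X) R) :
    exists r : R, (\int[m]_x (h x)%:E)%E = r%:E.
  have /andP[i0 i1] := integral_unit_bounds (probability_setT m) hU.
  exists (fine (\int[m]_x (h x)%:E)%E).
  by rewrite fineK// ge0_fin_numE// (le_lt_trans i1)// ltry.
have := boundE mu mu'; have := boundE mu' mu.
have [a ->] := finE (kernel_iter Q t mu).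
have [b ->] := finE (kernel_iter Q t mu').
by rewrite [X in (_ * (_ * X))%E]addeC => ba ab; exact: abse_subr_le.
Qed.
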